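(* Let $R$ be an E-ring and let $X\subseteq R$ be any subset. Then $$\operatorname{E-rad}(X)=\operatorname{T_2-rad}(X)=\sqrt[E]{X}.$$
   Context: An E-ring is a pair $(R,E)$ where $R$ is a commutative ring with $1$, assumed to be a $\mathbb{Q}$-algebra, and $E:(R,+)\to(R^*,\cdot)$ is a group homomorphism. An E-ideal is an ideal $I$ such that $\alpha\in I$ implies $E(\alpha)-1\in I$; it is prime if it is prime as an ideal. For $X\subseteq R$, $(X)^E$ denotes the E-ideal of $R$ generated by $X$. For $X\subseteq R$ and $b\in R$, $Xb$ denotes $X\cup\{b\}$. E-radical: $\operatorname{E-rad}(X)$ is the intersection of all prime E-ideals $P$ of $R$ with $P\supseteq X$ (equal to $R$ if there are none). Horn clauses: let $\mathcal{L}=\{+,-,\cdot,e^x,0,1\}\cup\{V\}$ with $V$ a unary predicate. For an E-ring $R$ and $J\subseteq R$, $(R,J)$ is the $\mathcal{L}$-structure in which $e^x$ is interpreted by $E$ and $V$ by $J$. A strict Horn clause is a formula $V(p_1)\wedge\dots\wedge V(p_k)\rightarrow V(q)$ with $k\ge 0$ and $p_1,\dots,p_k,q$ $\mathcal{L}$-terms (for $k=0$ it is just $V(q)$); free variables are understood as universally quantified. $T_2$ is the set of all strict Horn clauses $\alpha$ such that $(R,J)\models\alpha$ for every E-ring $R$ and every prime E-ideal $J$ of $R$. $\operatorname{T_2-rad}(X)$ is the smallest subset $Y\subseteq R$ with $X\subseteq Y$ and $(R,Y)\models T_2$, i.e. the intersection of all such $Y$. The operators $\sqrt[n]{\ }$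 on subsets of $R$, for $n\in\mathbb{N}$, are defined inductively by $$\sqrt[0]{X}=(X)^E,\qquad \sqrt[n+1]{X}=\sqrt[n]{\{a\in R:\ \exists\, b_1,b_2\in R\ \text{ with } b_1b_2\in\sqrt[n]{X}\ \text{and}\ a\in\sqrt[n]{Xb_1}\cap\sqrt[n]{Xb_2}\}},$$ and $\sqrt[E]{X}:=\bigcup_{n\in\mathbb{N}}\sqrt[n]{X}$. *)

(* Defs.v *)
From Stdlib Require List.
From mathcomp Require Import all_boot all_order all_algebra.
From mathcomp Require Import boolp classical_sets.

Set Implicit Arguments.
Unset Strict Implicit.
Unset Printing Implicit Defensive.

Import GRing.Theory.

Local Open Scope classical_set_scope.
Local Open Scope ring_scope.

(* The carrier is a comPzRingType, so that the zero ring is allowed; MathComp's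
   algebra structures (comAlgType rat) would force 1 != 0.  The Q-algebra
   structure is therefore given by its structure morphism. *)
Record ering := ERing {
  ering_sort :> comPzRingType;
  ering_rat : {rmorphism rat -> ering_sort};
  ering_exp : ering_sort -> ering_sort;
  ering_exp_unit : forall x, exists y, ering_exp x * y = 1;
  ering_expD : forall x y, ering_exp (x + y) = ering_exp x * ering_exp y
}.

Definition is_ideal (R : comPzRingType) (I : set R) : Prop :=
  [/\ I 0,
      forall a b, I a -> I b -> I (a + b)
    & forall r a, I a -> I (r * a)].

(* Prime ideals are proper. *)
Definition is_prime_ideal (R : comPzRingType) (I : set R) : Prop :=
  [/\ is_ideal I, ~ I 1 & forall a b, I (a * b) -> I a \/ I b].

Definition is_Eideal (R : ering) (I : set R) : Prop :=
  is_ideal I /\ (forall a, I a -> I (ering_exp a - 1)).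

Definition is_prime_Eideal (R : ering) (P : set R) : Prop :=
  is_Eideal P /\ is_prime_ideal P.

(* [smallest C X] is the intersection of all Y containing X with C Y. *)
Definition Egen (R : ering) (X : set R) : set R := smallest (@is_Eideal R) X.

(* The empty intersection is the whole ring. *)
Definition Erad (R : ering) (X : set R) : set R :=
  \bigcap_(P in [set P | is_prime_Eideal P /\ X `<=` P]) P.

Inductive eterm : Type :=
  | TVar of nat
  | TZero
  | TOne
  | TOpp of eterm
  | TAdd of eterm & eterm
  | TMul of eterm & eterm
  | TExp of eterm.

Fixpoint eval_eterm (R : ering) (v : nat -> R) (t : eterm) : R :=
  match t with
  | TVar i => v i
  | TZero => 0
  | TOne => 1
  | TOpp t1 => - eval_eterm v t1
  | TAdd t1 t2 => eval_eterm v t1 + eval_eterm v t2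
  | TMul t1 t2 => eval_eterm v t1 * eval_eterm v t2
  | TExp t1 => ering_exp (eval_eterm v t1)
  end.

(* [Horn [:: p_1; ...; p_k] q] is V(p_1) /\ ... /\ V(p_k) -> V(q). *)
Record horn := Horn { horn_prem : seq eterm; horn_concl : eterm }.

(* (R, J) |= c, the free variables being universally quantified. *)
Definition horn_sat (R : ering) (J : set R) (c : horn) : Prop :=
  forall v : nat -> R,
    (forall p, List.In p (horn_prem c) -> J (eval_eterm v p)) ->
    J (eval_eterm v (horn_concl c)).

Definition T2 : set horn :=
  [set c | forall (R : ering) (J : set R), is_prime_Eideal J -> horn_sat J c].

Definition T2_model (R : ering) (Y : set R) : Prop :=
  forall c, T2 c -> horn_sat Y c.

Definition T2rad (R : ering) (X : set R) : set R := smallest (@T2_model R) X.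

Fixpoint nroot (R : ering) (n : nat) (X : set R) : set R :=
  match n with
  | 0 => Egen X
  | m.+1 =>
      nroot m [set a | exists b1 b2 : R,
                 nroot m X (b1 * b2) /\
                 (nroot m (X `|` [set b1]) `&` nroot m (X `|` [set b2])) a]
  end.

Definition Eroot (R : ering) (X : set R) : set R :=
  \bigcup_(n in [set: nat]) nroot n X.

(* Main.v *)
From Stdlib Require List.
Require Import Defs.
From mathcomp Require Import all_boot all_order all_algebra.
From mathcomp Require Import boolp classical_sets.

(** The three sets are compared around the cycle
    [Eroot X `<=` T2rad X `<=` Erad X `<=` Eroot X].

    [T2rad X `<=` Erad X] holds because every prime E-ideal is a model of the
    strict Horn theory of prime E-ideals.

    [Erad X `<=` Eroot X] is a Krull-type argument.  The operator [Eroot] is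
    idempotent, commutes with directed unions, has E-ideals as values, and
    satisfies the branching rule [Eroot_branch]: what lies in the root both after
    adding [b1] to X and after adding [b2] lies in the root of X, provided
    [b1 * b2] does.  Directed continuity
    lets Zorn's lemma extend X to a set Y maximal for not having [a] in its
    root ([Eroot_separation]); idempotence makes Y equal to its root, and the
    branching rule makes Y prime.

    [Eroot X `<=` T2rad X] turns the construction of an element of [Eroot X]
    into a Horn clause.  Use the elements of R themselves as variables, and
    interpret them in an arbitrary E-ring with a distinguished prime E-ideal.
    Call a property of such interpretations *forced* by Y when it follows from
    finitely many conditions [V(p)], where the term p takes, in R itself, a
    value which is 0 or in Y.  The forced properties form a filter, and the
    elements [a] for which [V(a)] is forced by Y form an E-ideal containing Y
    ([forced_Eideal]), are closed under the branching rule ([forced_branch])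
    and under iteration ([forced_idem]); so they include every [nroot n Y].
    On the other hand forcing is a finite condition, so after renaming the
    finitely many variables involved it is a member of [T2], and a model of
    [T2] contains whatever it forces ([T2_model_forced]). *)

Set Implicit Arguments.
Unset Strict Implicit.
Unset Printing Implicit Defensive.

Import GRing.Theory.

Local Open Scope classical_set_scope.
Local Open Scope ring_scope.

(** * Ideals and directed unions *)

Lemma ideal_trans (R : comPzRingType) (I : set R) (x y : R) :
  is_ideal I -> I (x - y) -> I y -> I x.
Proof. by move=> [_ ID _] Ixy Iy; rewrite -(subrK y x); apply: ID. Qed.

Lemma ideal_transr (R : comPzRingType) (I : set R) (x y : R) :
  is_ideal I -> I (x - y) -> I x -> I y.
Proof.
move=> II Ixy; apply: (ideal_trans II).
by case: II => _ _ IM; rewrite -opprB -mulN1r; apply: IM.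
Qed.

Lemma Egen_Eideal (R : ering) (X : set R) : is_Eideal (Egen X).
Proof.
split; first split.
- by move=> P [[[P0 _ _] _] _].
- move=> a b Ga Gb P PX; case: (PX) => [[[_ PD _] _] _].
  by apply: PD; [apply: Ga|apply: Gb].
- by move=> r a Ga P PX; case: (PX) => [[[_ _ PM] _] _]; apply: PM; apply: Ga.
- by move=> a Ga P PX; case: (PX) => [[_ PE] _]; apply: PE; apply: Ga.
Qed.

Definition directed (T I : Type) (D : set I) (F : I -> set T) : Prop :=
  D !=set0 /\
  forall i j, D i -> D j -> exists2 k, D k & F i `<=` F k /\ F j `<=` F k.

Lemma directed_homo (T U I : Type) (D : set I) (F : I -> set T)
    (phi : set T -> set U) :
  {homo phi : A B / A `<=` B} -> directed D F -> directed D (phi \o F).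
Proof.
move=> phiS [D0 dF]; split=> // i j Di Dj.
by have [k Dk [ik jk]] := dF i j Di Dj; exists k => //; split; apply: phiS.
Qed.

Lemma Eideal_bigcup (R : ering) (I : Type) (D : set I) (F : I -> set R) :
  directed D F -> (forall i, D i -> is_Eideal (F i)) ->
  is_Eideal (\bigcup_(i in D) F i).
Proof.
move=> [[i0 Di0] dF] FE; split; first split.
- by exists i0 => //; have [[]] := FE _ Di0.
- move=> a b [i Di Fia] [j Dj Fjb]; have [k Dk [ik jk]] := dF i j Di Dj.
  have [[_ FD _] _] := FE _ Dk.
  by exists k => //; apply: FD; [apply: ik|apply: jk].
- move=> r a [i Di Fia]; have [[_ _ FM] _] := FE _ Di.
  by exists i => //; apply: FM.
- move=> a [i Di Fia]; have [_ FX] := FE _ Di.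
  by exists i => //; apply: FX.
Qed.

(** * The iterated roots *)

Section Roots.
Variable R : ering.
Implicit Types (X Y : set R) (a b : R) (n m : nat).

(** The set to which the n-th root is applied when forming the next one. *)
Definition branch (phi : set R -> set R) X : set R :=
  [set a | exists b1 b2 : R,
     phi X (b1 * b2) /\ (phi (X `|` [set b1]) `&` phi (X `|` [set b2])) a].

Lemma nrootS n X : nroot n.+1 X = nroot n (branch (nroot n) X).
Proof. by []. Qed.

Lemma branch_homo (phi : set R -> set R) :
  {homo phi : X Y / X `<=` Y} -> {homo branch phi : X Y / X `<=` Y}.
Proof.
move=> phiS X Y XY a [b1 [b2 [Xb [a1 a2]]]].
exists b1, b2; split; first exact: (phiS _ _ XY).
by split; [apply: (phiS (X `|` [set b1])) a1|apply: (phiS (X `|` [set b2])) a2];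
  apply: setSU.
Qed.

Lemma nroot_homo n : {homo @nroot R n : X Y / X `<=` Y}.
Proof.
elim: n => [|n IH] X Y XY.
  by move=> a Xa P [PE YP]; apply: Xa; split=> // ? /XY/YP.
rewrite !nrootS; exact: IH (branch_homo IH XY).
Qed.

Lemma nroot_Eideal n X : is_Eideal (nroot n X).
Proof. by elim: n X => [|n IH] X; [apply: Egen_Eideal|rewrite nrootS]. Qed.

(** Branching over [0 * 0] is no condition at all. *)
Lemma sub_nroot_branch n X : nroot n X `<=` branch (nroot n) X.
Proof.
move=> a Xa; exists 0, 0; rewrite mul0r; split; first by have [[]] := nroot_Eideal n X.
by split; apply: nroot_homo Xa; apply: subsetUl.
Qed.

Lemma sub_nroot n X : X `<=` nroot n X.
Proof.
elim: n X => [|n IH] X; first by move=> a Xa P [_]; apply.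
by rewrite nrootS => a /IH/sub_nroot_branch/IH.
Qed.

Lemma nroot_nroot n X : nroot n (nroot n X) `<=` nroot n.+1 X.
Proof. by rewrite nrootS; apply: nroot_homo; apply: sub_nroot_branch. Qed.

Lemma nroot_leq n m X : (n <= m)%N -> nroot n X `<=` nroot m X.
Proof.
move=> /subnK <-; elim: (m - n)%N => [|k IH] a //= /IH Xa.
by apply: nroot_nroot; apply: sub_nroot.
Qed.

(** Finitarity of the roots, stated without finite sets: the induction has to
    apply the hypothesis both to [F i `|` [set b]] and to [branch _ (F i)], and
    directedness is inherited by these families. *)
Lemma nroot_bigcup n (I : Type) (D : set I) (F : I -> set R) :
  directed D F ->
  nroot n (\bigcup_(i in D) F i) `<=` \bigcup_(i in D) nroot n (F i).
Proof.
elim: n F => [|n IH] F dF.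
  move=> a; apply; split; last by move=> x [i Di Fx]; exists i => //; apply: (@sub_nroot 0).
  apply: (@Eideal_bigcup _ _ _ (@nroot R 0 \o F)) => [|i _]; last exact: Egen_Eideal.
  exact: directed_homo (@nroot_homo 0) dF.
have branchU :
    branch (nroot n) (\bigcup_(i in D) F i) `<=` \bigcup_(i in D) branch (nroot n) (F i).
  have addU b : \bigcup_(i in D) F i `|` [set b] `<=` \bigcup_(i in D) (F i `|` [set b]).
    have [[i0 Di0] _] := dF.
    by move=> x [[i Di Fx]|bx]; [exists i => //; left|exists i0 => //; right].
  have addD b : directed D (fun i => F i `|` [set b]).
    by apply: (@directed_homo _ _ _ _ _ (setU^~ [set b])) dF => X Y XY; apply: setSU.
  move=> a [b1 [b2 [/(IH _ dF)[i Di Fib]]]].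
  move=> [/(nroot_homo (addU b1))/(IH _ (addD b1))[j Dj Fja]].
  move=> /(nroot_homo (addU b2))/(IH _ (addD b2))[k Dk Fka].
  have [_ dF'] := dF; have [l Dl [il jl]] := dF' i j Di Dj.
  have [m Dm [lm km]] := dF' l k Dl Dk.
  exists m => //; exists b1, b2; split.
    by apply: nroot_homo Fib; apply: subset_trans lm.
  split; first by apply: nroot_homo Fja; apply: setSU; apply: subset_trans lm.
  by apply: nroot_homo Fka; apply: setSU.
rewrite nrootS => a /(nroot_homo branchU).
apply: (IH (branch (nroot n) \o F)); apply: directed_homo dF.
by apply: branch_homo; apply: nroot_homo.
Qed.

Lemma directed_nroot X : directed [set: nat] (fun n => nroot n X).
Proof.
split=> [|i j _ _]; first by exists 0%N.
exists (maxn i j) => //.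
by split; apply: nroot_leq; [apply: leq_maxl|apply: leq_maxr].
Qed.

Lemma Eroot_Eideal X : is_Eideal (Eroot X).
Proof.
by apply: Eideal_bigcup => [|n _]; [apply: directed_nroot|apply: nroot_Eideal].
Qed.

Lemma sub_Eroot X : X `<=` Eroot X.
Proof. by move=> a Xa; exists 0%N => //; apply: sub_nroot. Qed.

Lemma Eroot_homo : {homo @Eroot R : X Y / X `<=` Y}.
Proof. by move=> X Y XY a [n _ Xa]; exists n => //; apply: nroot_homo Xa. Qed.

Lemma Eroot_idem X : Eroot (Eroot X) `<=` Eroot X.
Proof.
move=> a [n _ /(nroot_bigcup (directed_nroot X))[m _ a_nm]].
exists (maxn n m).+1 => //; apply: nroot_nroot.
apply: (nroot_leq (leq_maxl n m)); apply: nroot_homo a_nm.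
exact: nroot_leq (leq_maxr n m).
Qed.

Lemma Eroot_bigcup (I : Type) (D : set I) (F : I -> set R) :
  directed D F -> Eroot (\bigcup_(i in D) F i) `<=` \bigcup_(i in D) Eroot (F i).
Proof.
by move=> dF a [n _ /(nroot_bigcup dF)[i Di Fa]]; exists i => //; exists n.
Qed.

Lemma Eroot_branch X a b1 b2 :
  Eroot X (b1 * b2) -> Eroot (X `|` [set b1]) a -> Eroot (X `|` [set b2]) a ->
  Eroot X a.
Proof.
move=> [n _ Xb] [m1 _ a1] [m2 _ a2]; pose m := maxn n (maxn m1 m2).
exists m.+1 => //; rewrite nrootS; apply: sub_nroot; exists b1, b2.
have ge1 : (m1 <= m)%N by rewrite !leq_max leqnn !orbT.
have ge2 : (m2 <= m)%N by rewrite !leq_max leqnn !orbT.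
split; first by apply: nroot_leq Xb; apply: leq_maxl.
by split; [apply: nroot_leq ge1 _ a1|apply: nroot_leq ge2 _ a2].
Qed.

(** The prime E-ideal is a set maximal among those whose root omits [a]; such a
    set equals its root, and if [b1], [b2] lay outside it, [a] would be in the
    root of both enlargements, hence [b1 * b2] outside by branching. *)
Lemma Eroot_separation X a :
  ~ Eroot X a -> exists P, [/\ is_prime_Eideal P, X `<=` P & ~ P a].
Proof.
move=> Xa; pose omits Y := ~ Eroot (X `|` Y) a.
(* Zorn's lemma also asks for the union of the empty chain, hence [X `|` Y]. *)
have [F Fomits Ftot|Y [Ya Ymax]] := @Zorn_bigcup R omits.
  have [F0|nF0] := pselect (F !=set0); last first.
    move=> aF; apply: Xa; apply: Eroot_homo aF.
    by move=> x [//|[Y FY _]]; case: nF0; exists Y.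
  have dF : directed F (setU X).
    split=> // Y Z FY FZ; have [YZ|ZY] := Ftot Y Z FY FZ.
      by exists Z => //; split=> //; apply: setUS.
    by exists Y => //; split=> //; apply: setUS.
  move=> aF; have [|Y FY] := Eroot_bigcup dF (t := a); last exact: Fomits.
  have [Y0 FY0] := F0; apply: Eroot_homo aF => x [Xx|[Y FY Yx]].
    by exists Y0 => //; left.
  by exists Y => //; right.
pose P := Eroot (X `|` Y).
have YP : Y `<=` P by move=> y Yy; apply: sub_Eroot; right.
have XP : X `<=` P by move=> x Xx; apply: sub_Eroot; left.
have Pmax b : ~ P b -> Eroot (P `|` [set b]) a.
  move=> Pb; apply: contrapT => aPb; apply: (Ymax (P `|` [set b])).
    split; first by move=> y Yy; left; apply: YP.
    by move=> /(_ b (or_intror erefl)) /YP.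
  move=> aXPb; apply: aPb; apply: Eroot_homo aXPb.
  by move=> x [/XP|]; [left|].
have PE : is_Eideal P by apply: Eroot_Eideal.
exists P; split=> //; split=> //; split; first by case: PE.
  by move=> P1; apply: Ya; case: PE => [[_ _ PM] _]; rewrite -(mulr1 a); apply: PM.
move=> b1 b2 Pb; apply: contrapT => /not_orP[Pb1 Pb2]; apply: Ya.
apply: Eroot_idem; apply: (Eroot_branch _ (Pmax _ Pb1) (Pmax _ Pb2)).
exact: sub_Eroot.
Qed.

Lemma Erad_sub_Eroot X : Erad X `<=` Eroot X.
Proof.
move=> a Xa; apply: contrapT => /Eroot_separation[P [PP XP]]; apply.
exact: Xa.
Qed.

End Roots.

(** * Forcing by finitely many Horn premises *)

(** The language of [eterm] with variables taken from any type, so that the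
    elements of a ring can name themselves and no renaming apart is needed
    when premises are put together. *)
Inductive vterm (A : Type) : Type :=
  | VVar of A
  | VZero
  | VOne
  | VOpp of vterm A
  | VAdd of vterm A & vterm A
  | VMul of vterm A & vterm A
  | VExp of vterm A.

Arguments VZero {A}.
Arguments VOne {A}.

Fixpoint veval (A : Type) (R : ering) (w : A -> R) (t : vterm A) : R :=
  match t with
  | VVar x => w x
  | VZero => 0
  | VOne => 1
  | VOpp t1 => - veval w t1
  | VAdd t1 t2 => veval w t1 + veval w t2
  | VMul t1 t2 => veval w t1 * veval w t2
  | VExp t1 => ering_exp (veval w t1)
  end.

Fixpoint vvars (A : Type) (t : vterm A) : seq A :=
  match t with
  | VVar x => [:: x]
  | VZero | VOne => [::]
  | VOpp t1 | VExp t1 => vvars t1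
  | VAdd t1 t2 | VMul t1 t2 => vvars t1 ++ vvars t2
  end.

Fixpoint eterm_of (A : Type) (f : A -> nat) (t : vterm A) : eterm :=
  match t with
  | VVar x => TVar (f x)
  | VZero => TZero
  | VOne => TOne
  | VOpp t1 => TOpp (eterm_of f t1)
  | VAdd t1 t2 => TAdd (eterm_of f t1) (eterm_of f t2)
  | VMul t1 t2 => TMul (eterm_of f t1) (eterm_of f t2)
  | VExp t1 => TExp (eterm_of f t1)
  end.

Lemma eval_eterm_of (A : Type) (R : ering) (f : A -> nat) (v : nat -> R)
    (t : vterm A) :
  eval_eterm v (eterm_of f t) = veval (v \o f) t.
Proof. by elim: t => //= [t ->|t -> u ->|t -> u ->|t ->]. Qed.

Lemma eq_veval (A : eqType) (R : ering) (w w' : A -> R) (t : vterm A) :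
  {in vvars t, w =1 w'} -> veval w t = veval w' t.
Proof.
elim: t => //= [x|t IH|t IHt u IHu|t IHt u IHu|t IH] ww'; rewrite ?IH //.
- by apply: ww'; rewrite inE.
- by rewrite IHt ?IHu // => x tx; apply: ww'; rewrite mem_cat tx ?orbT.
- by rewrite IHt ?IHu // => x tx; apply: ww'; rewrite mem_cat tx ?orbT.
Qed.

Record interp (A : Type) := Interp {
  interp_ring : ering;
  interp_ideal : set interp_ring;
  interp_prime : is_prime_Eideal interp_ideal;
  interp_val : A -> interp_ring
}.

Arguments interp_ideal {A} i _.
Arguments interp_prime {A} i.
Arguments interp_val {A} i _.

Definition interp_V (A : Type) (M : interp A) (t : vterm A) : Prop :=
  interp_ideal M (veval (interp_val M) t).

Section Forcing.
Variable R : ering.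
Implicit Types (X Y : set R) (a b : R) (t : vterm R) (C D : interp R -> Prop).

(** Terms of value 0 are allowed as premises, so that the finitely many
    identities of R needed in an argument can be used, modulo the ideal. *)
Definition forced Y C : Prop :=
  exists L : seq (vterm R),
    (forall t, List.In t L -> veval id t = 0 \/ Y (veval id t)) /\
    (forall M, (forall t, List.In t L -> interp_V M t) -> C M).

Definition forced_set Y : set R :=
  [set a | forced Y (fun M => interp_V M (VVar a))].

Lemma forced_imp Y C D : (forall M, C M -> D M) -> forced Y C -> forced Y D.
Proof. by move=> CD [L [LY LC]]; exists L; split=> // M /LC/CD. Qed.

Lemma forced_and Y C D :
  forced Y C -> forced Y D -> forced Y (fun M => C M /\ D M).
Proof.
move=> [L [LY LC]] [K [KY KD]]; exists (L ++ K)%list; split.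
  by move=> t /List.in_app_iff[/LY|/KY].
by move=> M LK; split; [apply: LC|apply: KD] => t tL; apply: LK;
  apply/List.in_app_iff; [left|right].
Qed.

Lemma forced_term Y t :
  veval id t = 0 \/ Y (veval id t) -> forced Y (fun M => interp_V M t).
Proof.
by move=> tY; exists [:: t]; split=> [u [<-|]|M] //; apply; left.
Qed.

(** Each computation made in R is forced modulo the ideal: these are the
    instances of the diagram of R. *)
Lemma forced_diagram Y t :
  forced Y (fun M => interp_V M (VAdd t (VOpp (VVar (veval id t))))).
Proof. by apply: forced_term; left; rewrite /= subrr. Qed.

Lemma forced_eval Y t :
  forced Y (fun M => interp_V M t <-> interp_V M (VVar (veval id t))).
Proof.
apply: forced_imp (forced_diagram Y t) => M.
have [[II _] _] := interp_prime M; rewrite /interp_V /=.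
by split; [apply: ideal_transr|apply: ideal_trans].
Qed.

(** Cut.  The side condition C makes it cover hypothetical premises as well. *)
Lemma forced_cut Y Y' C D :
  (forall a, Y a -> forced Y' (fun M => C M -> interp_V M (VVar a))) ->
  forced Y D -> forced Y' (fun M => C M -> D M).
Proof.
move=> YY' [L [LY LD]].
apply: (@forced_imp _ (fun M => forall t, List.In t L -> C M -> interp_V M t)).
  by move=> M ML CM; apply: LD => t tL; apply: ML.
elim: L LY {LD} => [|t L IH] LY; first by exists [::].
have {}IH := IH (fun u uL => LY u (or_intror uL)).
have Vt : forced Y' (fun M => C M -> interp_V M t).
  have [t0|/YY' Yt] := LY t (or_introl erefl).
    by apply: forced_imp (forced_term (or_introl t0)) => M.
  apply: forced_imp (forced_and (forced_eval Y' t) Yt) => M [tM aM] CM.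
  by apply/tM/aM.
by apply: forced_imp (forced_and Vt IH) => M [Mt ML] u [<-|/ML].
Qed.

Lemma forced_Eideal Y : is_Eideal (forced_set Y).
Proof.
split; first split.
- by apply: forced_term; left.
- move=> a b Ya Yb.
  apply: forced_imp (forced_and (forced_eval Y (VAdd (VVar a) (VVar b)))
    (forced_and Ya Yb)) => M [MV [Ma Mb]]; apply/MV.
  by have [[[_ ID _] _] _] := interp_prime M; apply: ID.
- move=> r a Ya.
  apply: forced_imp (forced_and (forced_eval Y (VMul (VVar r) (VVar a))) Ya).
  move=> M [MV Ma]; apply/MV.
  by have [[[_ _ IM] _] _] := interp_prime M; apply: IM.
- move=> a Ya.
  apply: forced_imp
    (forced_and (forced_eval Y (VAdd (VExp (VVar a)) (VOpp VOne))) Ya).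
  move=> M [MV Ma]; apply/MV.
  by have [[_ IE] _] := interp_prime M; apply: IE.
Qed.

Lemma sub_forced Y : Y `<=` forced_set Y.
Proof. by move=> a Ya; apply: forced_term; right. Qed.

Lemma forced_idem Y : forced_set (forced_set Y) `<=` forced_set Y.
Proof.
move=> a YYa; apply: forced_imp (@forced_cut _ Y (fun=> True) _ _ YYa).
  by move=> M; apply.
by move=> b; apply: forced_imp.
Qed.

Lemma forced_homo : {homo forced_set : X Y / X `<=` Y}.
Proof.
move=> X Y XY a [L [LX LV]]; exists L; split=> // t /LX[|/XY]; by [left|right].
Qed.

Lemma forced_deduction Y a b :
  forced_set (Y `|` [set b]) a ->
  forced Y (fun M => interp_V M (VVar b) -> interp_V M (VVar a)).
Proof.
apply: forced_cut => c [Yc|->]; last by exists [::].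
by apply: forced_imp (sub_forced Yc) => M.
Qed.

(** Closure under branching is where primality of the interpreting ideals is
    used: [V(b1 * b2)] gives [V(b1)] or [V(b2)], and each yields [V(a)]. *)
Lemma forced_branch Y : branch forced_set Y `<=` forced_set Y.
Proof.
move=> a [b1 [b2 [Yb [/forced_deduction a1 /forced_deduction a2]]]].
apply: forced_imp (forced_and (forced_eval Y (VMul (VVar b1) (VVar b2)))
  (forced_and Yb (forced_and a1 a2))) => M [MV [Mb [M1 M2]]].
have [_ [_ _ Iprime]] := interp_prime M.
by have /Iprime[/M1|/M2] := MV.2 Mb.
Qed.

(** The set rooted at stage [n.+1] is made of forced elements, by branching, and
    what it forces is forced by Y, by the cut. *)
Lemma nroot_forced n Y : nroot n Y `<=` forced_set Y.
Proof.
elim: n Y => [|n IH] Y.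
  by move=> a; apply; split; [apply: forced_Eideal|apply: sub_forced].
rewrite nrootS => a /IH YYa; apply: forced_idem; apply: forced_homo YYa.
move=> c [b1 [b2 [Yb [c1 c2]]]]; apply: forced_branch; exists b1, b2.
by split; [apply: IH Yb|split; apply: IH].
Qed.

(** The premises forcing [a] become a Horn clause of [T2] once each element of
    R is sent to its position in a list of the elements occurring; those not in
    the list all share one variable, which is harmless since an interpretation
    is an arbitrary function on R. *)
Lemma T2_model_forced Y : T2_model Y -> forced_set Y `<=` Y.
Proof.
move=> YT a [L [LY LV]].
pose s := a :: List.flat_map (@vvars R) L; pose f x := index x s.
pose c := Horn [seq eterm_of f t | t <- L] (eterm_of f (VVar a)).
have Tc : T2 c.
  move=> S J Jprime v vL; rewrite eval_eterm_of.
  apply: (LV (Interp Jprime (v \o f))) => t tL.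
  by rewrite /interp_V /= -eval_eterm_of; apply: vL; apply: List.in_map.
pose v i := nth 0 s i.
have vK : {in s, v \o f =1 id} by move=> x xs; rewrite /= /v nth_index.
have Y0 : Y 0.
  apply: (YT (Horn [::] TZero) _ (fun=> 0)) => // S J [[[J0 _ _] _] _] u _.
  exact: J0.
have s_vars t : List.In t L -> {subset vvars t <= s}.
  move=> tL x tx; rewrite inE; apply/orP; right.
  elim: L tL {LY LV s f c Tc v vK} => //= u L IH.
  by rewrite mem_cat => -[->|/IH->]; rewrite ?tx ?orbT.
have -> : a = eval_eterm v (horn_concl c) by rewrite /= /f /= eqxx.
apply: (YT c Tc) => _ /List.in_map_iff[t [<- tL]].
rewrite eval_eterm_of (@eq_veval _ _ _ id); last by move=> x /(s_vars t tL)/vK.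
by have [->|] := LY t tL.
Qed.

End Forcing.

(** * Comparison of the radicals *)

Lemma T2rad_sub_Erad (R : ering) (X : set R) : T2rad X `<=` Erad X.
Proof.
by move=> a Xa P [PP XP]; apply: Xa; split=> // c /(_ R P PP).
Qed.

Lemma Eroot_sub_T2rad (R : ering) (X : set R) : Eroot X `<=` T2rad X.
Proof.
move=> a [n _ Xa] Y [YT XY]; apply: T2_model_forced => //.
exact: nroot_forced (nroot_homo XY Xa).
Qed.

Theorem theorem5p9 (R : ering) (X : set R) :
  Erad X = T2rad X /\ T2rad X = Eroot X.
Proof.
have ET : Eroot X `<=` T2rad X := @Eroot_sub_T2rad R X.
have TR : T2rad X `<=` Erad X := @T2rad_sub_Erad R X.
have RE : Erad X `<=` Eroot X := @Erad_sub_Eroot R X.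
split; apply/seteqP; split=> //.
- exact: subset_trans ET.
- exact: subset_trans RE.
Qed.
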